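(* Let $A\subset\mathbb{R}^2$ be a regular compact set. Assume that there exists $u\in\mathbb{S}^1$ such that, for each $y\in u^\perp$, the section $A\cap(y+l_u)$ coincides, up to a set of $\lambda_1$-measure zero, with the union of its non-degenerate connected components (which are pairwise disjoint closed segments), and let $N(y)\in\{0,1,2,\dots\}\cup\{\infty\}$ be the number of these segments. If $$\sum_{i=0}^\infty (i-1)\,\lambda_1\{y\in\mathrm{conv}(A|u^\perp): N(y)=i\}\neq 0,$$ then $g_A\neq g_K$ for every convex body $K$ in $\mathbb{R}^2$.
   Context: A closed set is regular if it coincides with the closure of its interior. For a compact set $A\subset\mathbb{R}^2$, the covariogram is $g_A(x)=\lambda_2(A\cap(A+x))$, $x\in\mathbb{R}^2$. A convex body is a compact convex set with non-empty interior. $\lambda_2$ is Lebesgue measure in $\mathbb{R}^2$ and $\lambda_1$ is one-dimensional Lebesgue (Hausdorff) measure on lines. For $u\in\mathbb{S}^1$ (the unit circle), $u^\perp$ is the line through the origin orthogonal to $u$, $l_u$ is the line through the origin parallel to $u$, and $A|u^\perp$ is the orthogonal projection of $A$ on $u^\perp$. $\mathrm{conv}$ denotes convex hull. The sum is over finite integers $i\ge 0$ and may take the value $+\infty$ (which counts as $\neq 0$). *)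

(* Defs.v *)
From HB Require Import structures.
From mathcomp Require Import all_boot all_order all_algebra.
From mathcomp Require Import all_classical all_reals all_analysis.
From mathcomp Require Import ring.

Set Implicit Arguments.
Unset Strict Implicit.
Unset Printing Implicit Defensive.

Import Order.TTheory GRing.Theory Num.Theory.
Import numFieldNormedType.Exports.

Local Open Scope classical_set_scope.
Local Open Scope ring_scope.

(* [R^o] rather than [R] so that the product carries its [R]-module structure
   together with the product topology. *)
Definition plane (R : realType) : normedModType R := (R^o * R^o)%type.

Definition lambda2 (R : realType) : set (plane R) -> \bar R :=
  (@lebesgue_measure R \x @lebesgue_measure R)%E.

Definition covariogram (R : realType) (A : set (plane R)) (x : plane R) :
    \bar R :=
  lambda2 (A `&` [set a + x | a in A]).

Definition convex_body (R : realType) (K : set (plane R)) : Prop :=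
  [/\ compact K, convex_set K & K° !=set0].

Definition convex_hull (R : realType) (E : set (plane R)) : set (plane R) :=
  smallest (@convex_set R (plane R)) E.

Definition dot (R : realType) (u v : plane R) : R := u.1 * v.1 + u.2 * v.2.

Definition unit_circle (R : realType) : set (plane R) :=
  [set u | dot u u = 1].

Definition orth (R : realType) (u : plane R) : set (plane R) :=
  [set y | dot y u = 0].

(* A unit vector spanning [orth u] when [u] is on the unit circle. *)
Definition rot90 (R : realType) (u : plane R) : plane R := (- u.2, u.1).

(* [A | u^perp] for [u] on the unit circle. *)
Definition proj_orth (R : realType) (u : plane R) (A : set (plane R)) :
    set (plane R) :=
  [set p - dot p u *: u | p in A].

(* The line through [y] parallel to [u], i.e. [y + l_u]. *)
Definition line (R : realType) (y u : plane R) : set (plane R) :=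
  [set y + t *: u | t in [set: R]].

Lemma line_rot90 (R : realType) (u : plane R) :
  unit_circle u -> line 0 (rot90 u) = orth u.
Proof.
rewrite /unit_circle /orth /line /rot90 /dot /= => hu.
apply/seteqP; split=> [_ [t _ <-]|[a b] /= ab].
  have -> : (0 + t *: ((- u.2, u.1) : plane R) : plane R) =
            (t * - u.2, t * u.1) by rewrite add0r.
  rewrite /= ; ring.
exists (b * u.1 - a * u.2) => //; rewrite add0r.
have -> : ((b * u.1 - a * u.2) *: ((- u.2, u.1) : plane R) : plane R) =
          ((b * u.1 - a * u.2) * - u.2, (b * u.1 - a * u.2) * u.1) by [].
congr pair.
  transitivity (a * (u.1 * u.1 + u.2 * u.2) - u.1 * (a * u.1 + b * u.2)).
    by ring.
  by rewrite hu ab mulr1 mulr0 subr0.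
transitivity (b * (u.1 * u.1 + u.2 * u.2) - u.2 * (a * u.1 + b * u.2)).
  by ring.
by rewrite hu ab mulr1 mulr0 subr0.
Qed.

(* One-dimensional Lebesgue measure on [line y u], for [u] on the unit circle,
   transported along the arc-length parametrization [t |-> y + t u]. *)
Definition lambda1 (R : realType) (y u : plane R) (S : set (plane R)) :
    \bar R :=
  lebesgue_measure [set t : R | S (y + t *: u)].

Definition nondegenerate_components (R : realType) (S : set (plane R)) :
    set (set (plane R)) :=
  [set C | (exists2 x, S x & C = connected_component S x) /\
           (exists x y, [/\ C x, C y & x <> y])].

Definition chord (R : realType) (A : set (plane R)) (u y : plane R) :
    set (plane R) :=
  A `&` line y u.

(* [N(y)], with value [+oo] when there are infinitely many segments. *)
Definition segment_number (R : realType) (A : set (plane R)) (u y : plane R) :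
    \bar R :=
  counting (nondegenerate_components (chord A u y)).

(* Main.v *)
(* If [A] and [K] have the same covariogram then
   [(g_A 0 - g_A (r u)) / r = (g_K 0 - g_K (r u)) / r] for all [r > 0]. By
   Fubini in coordinates adapted to [u], the left-hand side is the integral over
   [y] of [lambda_1 (S \ (S + r)) / r], where [S] is the section of [A] through
   [y]. This quotient is at most [N y] and tends to [N y] as [r] tends to [0],
   so by Fatou's lemma the left-hand side tends to [\int N]; for the convex body
   [K] the same limit is the length of its projection on [u^perp]. Moreover
   [g_A] determines the width of [A] in the direction orthogonal to [u], since
   [g_A] is positive at differences of interior points of [A] and vanishes
   outside [A - A]. Hence [\int (N - 1)] over the convex hull of the projection
   of [A] is [0], and integrating over the level sets of [N] gives a vanishing
   sum. *)
Require Import Defs.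
From HB Require Import structures.
From mathcomp Require Import all_boot all_order all_algebra.
From mathcomp Require Import all_classical all_reals all_analysis.
From mathcomp Require Import finmap measurable_realfun lra ring.

Set Implicit Arguments.
Unset Strict Implicit.
Unset Printing Implicit Defensive.

Import Order.TTheory GRing.Theory Num.Theory.
Import numFieldNormedType.Exports.

Local Open Scope classical_set_scope.
Local Open Scope ring_scope.

(** * Shifts of subsets of the line *)

Lemma measure_mono d (T : measurableType d) (R : realType)
    (mu : {measure set T -> \bar R}) (A B : set T) :
  measurable A -> measurable B -> A `<=` B -> (mu A <= mu B)%E.
Proof. by move=> mA mB AB; apply: le_measure => //; exact: mem_set. Qed.

Lemma measurable_preimage_shift (R : realType) (a : R) (E : set R) :
  measurable E -> measurable ((fun x => x + a) @^-1` E).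
Proof.
move=> mE; rewrite -[X in measurable X]setTI.
by apply: (measurable_realfun.measurable_funD _ _ measurableT).
Qed.

(** The pushforward under a translation agrees with Lebesgue measure on half-open intervals, which
    determine the measure. *)
Lemma lebesgue_measure_shift (R : realType) (a : R) (E : set R) :
  measurable E ->
  lebesgue_measure ((fun x => x + a) @^-1` E) = lebesgue_measure E.
Proof.
move=> mE.
have mf : measurable_fun setT (fun x : measurableTypeR R =>
  x + a : measurableTypeR R).
  by move=> _ Y mY; rewrite setTI; exact: measurable_preimage_shift.
suff : pushforward (@lebesgue_measure R)
   (fun x : measurableTypeR R => x + a : measurableTypeR R) E =
     lebesgue_measure E by [].
apply/esym/lebesgue_measure_unique => //= _ [[b c]] _ <-.
rewrite /pushforward.
rewrite (_ : _ @^-1` _ = `]b - a, c - a]%classic); last first.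
  by apply/seteqP; split=> x /=; rewrite !in_itv/=; lra.
rewrite !lebesgue_measure_itv/= !lte_fin ltrD2r.
by case: ifP => // _; rewrite -!EFinB; congr EFin; ring.
Qed.

Lemma lebesgue_measure_itv_le (R : realType) (x y : bool) (a b : R) :
  a <= b ->
  lebesgue_measure ([set` Interval (BSide x a) (BSide y b)] : set R) =
  (b - a)%:E.
Proof.
move=> ab; rewrite lebesgue_measure_itv/= lte_fin; case: ifPn => //.
by rewrite -leNgt => ba; congr EFin; lra.
Qed.

(* The measures of [S] and of [S + r] in [`]g, z]] differ by those of the two
   end pieces [`]z - r, z]] and [`]g - r, g]]. *)
Lemma shift_difference_ge (R : realType) (S : set R) (g z r : R) :
  measurable S -> g <= z -> 0 <= r ->
  `]g - r, g] `&` S = set0 -> `]z - r, z] `<=` S ->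
  (r%:E <= lebesgue_measure
    ((S `\` (fun x => (x - r)%R) @^-1` S) `&` `]g, z]))%E.
Proof.
move=> mS gz r0 gS zS; set P := _ @^-1` S.
have mP : measurable P by exact: measurable_preimage_shift.
have mI (a b : R) : measurable (`]a, b]%classic : set R)
  by exact: measurable_itv.
have mSI (a b : R) : measurable (S `&` `]a, b]) by exact: measurableI.
have PE : lebesgue_measure (P `&` `]g, z]) =
  lebesgue_measure (S `&` `]g - r, z - r]).
  rewrite -[RHS](lebesgue_measure_shift (- r))//; congr lebesgue_measure.
  by apply/seteqP; split=> x /= []; rewrite !in_itv/= => ? ?; split => //; lra.
set S' := S `&` `]g - r, z - r] in PE.
(* The gap []g - r, g]] pushes [S'] into []g, z - r]], and it also keeps []z - r, z]], a part of
   [S], to the right of [g]. *)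
have SE : lebesgue_measure (S `&` `]g, z]) = (lebesgue_measure S' + r%:E)%E.
  have <- : lebesgue_measure (`]z - r, z] : set R) = r%:E.
    by rewrite lebesgue_measure_itv_le ?subKr// lerBlDr lerDl.
  rewrite -measureU//; [|exact: mSI|]; last first.
    by apply/seteqP; split=> x //=; rewrite /S'/= !in_itv/= => -[[_ ?]] ?; lra.
  congr lebesgue_measure; apply/seteqP; split=> x /=; rewrite /S'/= !in_itv/=.
    move=> [Sx ?]; have [?|?] := lerP x (z - r); last by right; lra.
    by left; split => //; lra.
  move=> [[Sx ?]|xz]; last first.
    have Sx : S x by apply: zS; rewrite /= in_itv.
    split => //; apply/andP; split; last lra.
    rewrite ltNge; apply/negP => xg.
    have : (`]g - r, g] `&` S) x by split => //=; rewrite in_itv/=; lra.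
    by rewrite gS.
  split => //; apply/andP; split; last lra.
  rewrite ltNge; apply/negP => xg.
  have : (`]g - r, g] `&` S) x by split => //=; rewrite in_itv/=; lra.
  by rewrite gS.
(* Finiteness allows [lebesgue_measure S'] to be cancelled: [S] in []g, z]] is covered by [P] and
   [S \ P], and the [P] part has exactly this measure. *)
have fin : lebesgue_measure S' \is a fin_num.
  rewrite ge0_fin_numE//.
  apply: (@le_lt_trans _ _ (lebesgue_measure (`]g - r, z - r] : set R))).
    by apply: measure_mono; [exact: mSI|exact: mI|exact: subIsetr].
  by rewrite lebesgue_measure_itv/=; case: ifP => _; rewrite ltry.
rewrite -(leeD2lE _ _ fin) -SE -[in leRHS]PE addeC.
have mD : measurable ((S `\` P) `&` `]g, z]) by apply: measurableI => //;
  exact: measurableD.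
have mPI : measurable (P `&` `]g, z]) by exact: measurableI.
apply: le_trans (measureU2 (@lebesgue_measure R) mD mPI).
apply: (@measure_mono _ _ _ (@lebesgue_measure R)).
- exact: mSI.
- exact: measurableU.
move=> x [Sx gxz]; have [Px|Px] := pselect (P x); first by right.
by left.
Qed.

(** If [x] in [C] is farther than [r] from [inf C], some point of [C] lies below [x - r], so
    convexity puts [x - r] in [C]. Only the initial piece of length [r] can survive. *)
Lemma interval_shift_difference_sub (R : realType) (C : set R) (r : R) :
  is_interval C -> has_lbound C -> 0 <= r ->
  (C `\` (fun x => (x - r)%R) @^-1` C) `<=` `[inf C, inf C + r].
Proof.
move=> iC lC r0 x [Cx Cxr]; rewrite /= in_itv/=; have ix := ge_inf lC Cx.
rewrite ix/= leNgt; apply/negP => xr; apply: Cxr => /=.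
have C0 : C !=set0 by exists x.
have xr' : inf C < x - r by rewrite ltrBrDr.
have [y Cy yx] := inf_lt C0 xr'.
by apply: (iC y x) => //; lra.
Qed.

(* Between two consecutive points of the list there is a gap of [S]; cutting the
   line at these gaps, each piece contributes at least [r]. *)
Lemma shift_difference_ge_size (R : realType) (S : set R) (s : seq R) (p : R) :
  closed S -> has_lbound S -> ~ S p -> all (< p) s ->
  sorted (fun z z' => `[< exists q, [/\ z' < q, q < z & ~ S q] >]) s ->
  (forall z, z \in s -> exists2 e, 0 < e & `]z - e, z] `<=` S) ->
  \forall r \near 0^'+, (((size s)%:R * r)%:E <=
    lebesgue_measure ((S `\` (fun x => (x - r)%R) @^-1` S) `&` `]-oo, p]))%E.
Proof.
move=> cS [l Sl]; have mS : measurable S by exact: closed_measurable.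
elim: s p => [|z s IH] p Sp sp ss sS.
  by apply: nearW => r; rewrite mul0r.
have [q [Sq sq qz]] : exists q, [/\ ~ S q, all (< q) s & q < z].
  case: s {IH sp sS} ss => [_|z' s /= /andP[/asboolP[q [zq qz Sq]] ps]].
    (* No point is left below [z], so anything under both [z] and the lower bound [l] serves as the
       gap. *)
    exists (Num.min (l - 1) (z - 1)); split => //; last first.
      by rewrite gt_min; apply/orP; right; lra.
    by move=> /Sl; rewrite le_min => /andP[]; lra.
  exists q; split => //=; rewrite zq/=.
  apply/allP => y ys; have := order_path_min _ ps.
  move=> /(_ _)/allP/(_ y ys)/asboolP[|q' [yq' q'z _]].
    move=> b a c /asboolP[q1 [? ? ?]] /asboolP[q2 [? ? ?]].
    by apply/asboolP; exists q1; split => //; lra.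
  by rewrite /=; lra.
have sS' y : y \in s -> exists2 e, 0 < e & `]y - e, y] `<=` S.
  by move=> ys; apply: sS; rewrite inE ys orbT.
have IHq := IH q Sq sq (path_sorted ss) sS'.
have [e e0 zS] := sS z (mem_head _ _).
(* As [S] is closed, the single missing point [q] yields a gap []q - r, q]] for all small [r]. *)
have [d /= d0 dS] : \forall x \near q, ~ S x by exact: (closed_openC cS).
near=> r.
have r0 : 0 < r by near: r; exact: nbhs_right_gt.
have rd : r < d by near: r; exact: nbhs_right_lt.
have re : r < e by near: r; exact: nbhs_right_lt.
have IHr : (((size s)%:R * r)%:E <=
    lebesgue_measure ((S `\` (fun x => (x - r)%R) @^-1` S) `&` `]-oo, q]))%E.
  by near: r.
set D := S `\` _ in IHr *.
have mD : measurable D by apply: measurableD => //;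
  exact: measurable_preimage_shift.
have mDI (i : interval R) : measurable (D `&` [set` i]).
  by apply: measurableI => //; exact: measurable_itv.
rewrite /= -natr1 mulrDl mul1r EFinD.
apply: (@le_trans _ _ (lebesgue_measure (D `&` `]-oo, q]) +
  lebesgue_measure (D `&` `]q, z]))%E).
  apply: leeD => //; apply: (shift_difference_ge mS (ltW qz) (ltW r0)).
    rewrite -subset0 => x [] /=; rewrite in_itv/= => xq; apply: dS.
    by rewrite /ball/= ltr_norml; lra.
  by apply: subset_trans zS => x /=; rewrite !in_itv/=; lra.
rewrite -measureU; [|exact: mDI|exact: mDI|]; last first.
  by apply/seteqP; split => x //= []; rewrite !in_itv/= => -[_ ?] [_ ?]; lra.
apply: (@measure_mono _ _ _ (@lebesgue_measure R)).
- by apply: measurableU; exact: mDI.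
- exact: mDI.
move: sp => /= /andP[zp _].
by move=> x [] [? xq]; split => //; move: xq; rewrite /= !in_itv/=; lra.
Unshelve. all: by end_near. Qed.

(** Up to a null set [S] is a union of intervals, and each keeps at most an initial piece of length
    [r]. For infinite [I] the bound is [+oo]. *)
Lemma shift_difference_le_counting (R : realType) (T : choiceType) (S : set R)
    (I : set T) (L : T -> set R) (r : R) :
  measurable S -> has_lbound S -> 0 < r ->
  (forall C, I C -> is_interval (L C)) -> (forall C, I C -> L C `<=` S) ->
  lebesgue_measure (S `\` \bigcup_(C in I) L C) = 0%E ->
  (lebesgue_measure (S `\` (fun x => (x - r)%R) @^-1` S) <=
    r%:E * counting I)%E.
Proof.
move=> mS [l Sl] r0 iL LS S0; rewrite /counting.
case: asboolP => [fI|_]; last by rewrite gt0_muley ?lte_fin// leey.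
set P := _ @^-1` S; have mP : measurable P by exact: measurable_preimage_shift.
have mL C : I C -> measurable (L C) by move=> /iL;
  exact: is_interval_measurable.
have mU : measurable (\bigcup_(C in I) L C) by exact: fin_bigcup_measurable.
have mSP : measurable (S `\` P) by exact: measurableD.
have mSPU : measurable ((S `\` P) `&` \bigcup_(C in I) L C)
  by exact: measurableI.
have h1 : (lebesgue_measure (S `\` P) <=
   lebesgue_measure (S `\` \bigcup_(C in I) L C) +
   lebesgue_measure ((S `\` P) `&` \bigcup_(C in I) L C))%E.
  have mSU : measurable (S `\` \bigcup_(C in I) L C) by exact: measurableD.
  apply: le_trans (measureU2 (@lebesgue_measure R) mSU mSPU).
  apply: (@measure_mono _ _ _ (@lebesgue_measure R));
    [exact: mSP|exact: (measurableU _ _ mSU mSPU)|].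
  move=> x SPx; have [Ux|Ux] := pselect ((\bigcup_(C in I) L C) x);
    first by right.
  by left; split => //; case: SPx.
apply: le_trans h1 _; rewrite [X in (X + _ <= _)%E]S0 add0e.
have h2 : (lebesgue_measure ((S `\` P) `&` \bigcup_(C in I) L C) <=
    \sum_(C \in I) (@lebesgue_measure R) `[inf (L C), (inf (L C) + r)%R])%E.
  apply: content_sub_fsum => //.
  (* A point outside [S + r] is also outside [L C + r], because [L C] is contained in [S]. *)
  move=> x [[Sx Px] [C IC LCx]]; exists C => //.
  apply: interval_shift_difference_sub => //.
  - exact: iL.
  - by exists l => y /(LS C IC)/Sl.
  - exact: ltW.
  - by split => // /(LS C IC).
apply: le_trans h2 _; under eq_fsbigr do
  rewrite lebesgue_measure_itv_le ?lerDl ?(ltW r0)// addrAC subrr add0r.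
rewrite fsbig_finite//= sumEFin big_const_seq count_predT iter_addr addr0
  -EFinM.
by rewrite lee_fin mulr_natr.
Qed.

Lemma counting_geP (R : realType) (T : choiceType) (I : set T) (k : nat) :
  (k%:R%:E <= @counting T R I)%E ->
  exists c : seq T, [/\ uniq c, size c = k & forall C, C \in c -> I C].
Proof.
move=> kI; have [F FI kF] :
  exists2 F : {fset T}, [set` F] `<=` I & (k <= #|` F|)%N.
  move: kI; rewrite /counting; case: asboolP => [fI|iI _].
    rewrite lee_fin ler_nat => kI; exists (fset_set I) => //.
    by move=> x /=; rewrite in_fset_set// => /set_mem.
  exact: infinite_set_fset.
exists (take k F); split.
- by rewrite take_uniq.
- exact: size_takel.
- by move=> C /mem_take CF; apply: FI.
Qed.

(** Choosing one point in each of [k] intervals and sorting them reduces this to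
    [shift_difference_ge_size]. A finite [k] replaces the full count because the admissible [r]
    depend on the chosen intervals and the count may be infinite. *)
Lemma shift_difference_ge_counting (R : realType) (T : choiceType) (S : set R)
    (I : set T) (L : T -> set R) (k : nat) :
  closed S -> has_lbound S -> has_ubound S ->
  (forall C, I C -> L C `<=` S) ->
  (forall C, I C -> exists z e, 0 < e /\ `[z - e, z] `<=` L C) ->
  (forall C C' z z', I C -> I C' -> C <> C' -> L C z -> L C' z' -> z' <= z ->
    exists q, [/\ z' < q, q < z & ~ S q]) ->
  (k%:R%:E <= @counting T R I)%E ->
  \forall r \near 0^'+, ((k%:R * r)%:E <=
    lebesgue_measure (S `\` (fun x => (x - r)%R) @^-1` S))%E.
Proof.
move=> cS lS [u Su] LS nL gL /counting_geP[c [uc <- cI]].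
have /choice[z zP] C : exists z : R, I C ->
  exists2 e, 0 < e & `[z - e, z] `<=` L C.
  have [IC|] := pselect (I C); last by exists 0.
  by have [z [e [e0 zL]]] := nL C IC; exists z => _; exists e.
have Lz C : I C -> L C (z C).
  by move=> /zP[e e0]; apply; rewrite /= in_itv/=; lra.
(* The order is decreasing, so that the induction over the list peels off the rightmost point
   first. *)
pose s := sort (fun C C' => z C' <= z C) c.
have sc : perm_eq s c by rewrite perm_sort.
have sI C : C \in s -> I C by rewrite (perm_mem sc); exact: cI.
have us : uniq s by rewrite (perm_uniq sc).
have ss : sorted (fun C C' => z C' <= z C) s.
  by apply: sort_sorted => C C'; exact: le_total.
have mS : measurable S by exact: closed_measurable.
(* The cut [u + 1] lies outside [S] and strictly above every chosen point. *)
have : \forall r \near 0^'+, (((size (map z s))%:R * r)%:E <=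
    lebesgue_measure
      ((S `\` (fun x => (x - r)%R) @^-1` S) `&` `]-oo, (u + 1)%R]))%E.
  apply: shift_difference_ge_size => //.
  - by move=> /Su; lra.
  - apply/allP => _ /mapP[C Cs ->] /=.
    by have /LS := Lz C (sI C Cs); move=> /(_ (sI C Cs))/Su; lra.
  - apply: pairwise_sorted; rewrite pairwise_map.
    (* Sorting only gives a weak inequality; distinctness of the indices is what lets [gL] produce a
       gap. *)
    have : pairwise (fun C C' => (z C' <= z C) && (C != C')) s.
      by rewrite pairwise_relI -uniq_pairwise us andbT -sorted_pairwise// =>
        a b d /[swap]; exact: le_trans.
    apply: sub_in_pairwise (allss s) => C C' Cs C's /andP[zz /eqP CC'].
    by apply/asboolP; apply: (gL C C') => //; do ?[apply: Lz]; exact: sI.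
  - move=> _ /mapP[C Cs ->]; have [e e0 zL] := zP C (sI C Cs).
    exists e => // x xz; apply: (LS C (sI C Cs)); apply: zL.
    by move: xz; rewrite /= !in_itv/=; lra.
apply: filterS => r; rewrite size_map (perm_size sc) => /le_trans; apply.
have mD : measurable (S `\` (fun x => x - r) @^-1` S).
  by apply: measurableD => //; exact: measurable_preimage_shift.
by apply: measure_mono => //; apply: measurableI => //; exact: measurable_itv.
Qed.

(** * Area in rotated coordinates *)

(* [plane R] with the product Borel sigma-algebra. *)
Definition mplane (R : realType) :=
  (measurableTypeR R * measurableTypeR R)%type.

(** An open set is the countable union of the squares with rational centre and radius that it
    contains. *)
Lemma open_measurable_plane (R : realType) (U : set (plane R)) :
  open U -> measurable (U : set (mplane R)).
Proof.
move=> oU.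
pose B (q : rat * rat * rat) : set (mplane R) :=
  [set` `]ratr q.1.1 - ratr q.2, ratr q.1.1 + ratr q.2[ ] `*`
  [set` `]ratr q.1.2 - ratr q.2, ratr q.1.2 + ratr q.2[ ].
rewrite (_ : U = \bigcup_(q in [set q | B q `<=` U]) B q); last first.
  apply/seteqP; split=> [p Up|p [q qU Bq]]; last exact: qU.
  have /nbhs_ballP[e /= e0 eU] : nbhs p U by apply: oU.
  (* The radius is below [e / 2]: the centre is within [r] of [p], so the square stays within
     [2 r < e] of [p]. *)
  have [r] := rat_in_itvoo (divr_gt0 e0 (ltr0n _ 2)).
  rewrite in_itv/= => /andP[r0 re].
  have near_rat (x : R) : x - ratr r < x + ratr r by lra.
  have [a] := rat_in_itvoo (near_rat p.1).
  have [b] := rat_in_itvoo (near_rat p.2).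
  rewrite !in_itv/= => pb pa.
  exists (a, b, r); last by split; rewrite /= in_itv/=; lra.
  move=> [x y] [/=]; rewrite !in_itv/= => xa yb; apply: eU.
  by split; rewrite /ball/= ltr_norml; lra.
rewrite bigcup_mkcond; apply: countable_bigcupT_measurable => // q.
by case: ifP => // _; apply: measurableX; exact: measurable_itv.
Qed.

(** [lambda2] integrates vertical sections by definition; uniqueness of the product measure allows
    horizontal ones instead. *)
Lemma lambda2_ysection (R : realType) (E : set (plane R)) :
  measurable (E : set (mplane R)) ->
  lambda2 E = (\int[lebesgue_measure]_y lebesgue_measure (ysection E y))%E.
Proof.
move=> mE; apply: (@product_measure_unique _ _ _ _ _ _ _
  [the measure _ _ of (@lebesgue_measure R \x^ @lebesgue_measure R)%E]) => //.
by move=> A B mA mB; rewrite /= product_measure2E.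
Qed.

Definition area_preserving (R : realType) (f : plane R -> plane R) : Prop :=
  forall E, measurable (E : set (mplane R)) ->
    measurable (f @^-1` E : set (mplane R)) /\ lambda2 (f @^-1` E) = lambda2 E.

Lemma area_preserving_comp (R : realType) (f g : plane R -> plane R) :
  area_preserving f -> area_preserving g -> area_preserving (f \o g).
Proof.
move=> pf pg E mE; have [mf fE] := pf _ mE; have [mg gE] := pg _ mf.
by split => //; rewrite comp_preimage gE.
Qed.

(** Each horizontal section is merely translated, so its length is unchanged. *)
Lemma area_preserving_hshear (R : realType) (a : R) :
  area_preserving (fun p : plane R => (p.1 + a * p.2, p.2)).
Proof.
move=> E mE; have mf : measurable_fun setT (fun p : mplane R =>
  (p.1 + a * p.2, p.2) : mplane R).
  apply/measurable_fun_pairP; split; last exact: measurable_snd.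
  by apply: measurable_funD => //; apply: measurable_funM.
have mfE : measurable ((fun p : plane R =>
  (p.1 + a * p.2, p.2)) @^-1` E : set (mplane R)).
  by rewrite -[X in measurable X]setTI; exact: mf.
split => //; rewrite !lambda2_ysection//; apply: eq_integral => y _.
rewrite -[RHS](lebesgue_measure_shift (a * y)); last exact: measurable_ysection.
by congr lebesgue_measure; apply/seteqP; split=> x; rewrite /= /ysection/= !inE.
Qed.

Lemma area_preserving_vshear (R : realType) (a : R) :
  area_preserving (fun p : plane R => (p.1, p.2 + a * p.1)).
Proof.
move=> E mE; have mf : measurable_fun setT (fun p : mplane R =>
  (p.1, p.2 + a * p.1) : mplane R).
  apply/measurable_fun_pairP; split; first exact: measurable_fst.
  by apply: measurable_funD => //; apply: measurable_funM.
have mfE : measurable ((fun p : plane R =>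
  (p.1, p.2 + a * p.1)) @^-1` E : set (mplane R)).
  by rewrite -[X in measurable X]setTI; exact: mf.
split => //; apply: eq_integral => x _ /=.
rewrite -[RHS](lebesgue_measure_shift (a * x)); last exact: measurable_xsection.
by congr lebesgue_measure; apply/seteqP; split=> y; rewrite /= /xsection/= !inE.
Qed.

(** For a unit vector [u] this is the rotation taking the first basis vector to [u]: [p.1] is arc
    length along [u], [p.2] the position on the orthogonal line. *)
Definition frame (R : realType) (u p : plane R) : plane R :=
  p.1 *: u + p.2 *: rot90 u.

Lemma frameE (R : realType) (u p : plane R) :
  frame u p = (u.1 * p.1 - u.2 * p.2, u.2 * p.1 + u.1 * p.2).
Proof.
by case: u p => [a b] [x y]; congr pair => /=; rewrite /GRing.scale/=; ring.
Qed.

Lemma area_preserving_frame (R : realType) (u : plane R) :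
  unit_circle u -> area_preserving (frame u).
Proof.
rewrite /unit_circle/= /dot => u1.
(* A rotation that is not [x |-> x] or [x |-> - x] is a product of three shears;
   the remaining two are products of two such rotations. *)
have main (w : plane R) : w.1 * w.1 + w.2 * w.2 = 1 -> w.2 != 0 ->
    area_preserving (frame w).
  (* Writing [w] as [(cos t, sin t)], the shear coefficient [a] is [- tan (t / 2)]. *)
  move=> w1 w2; pose a := (w.1 - 1) / w.2.
  rewrite (_ : frame w = (fun p : plane R => (p.1 + a * p.2, p.2)) \o
      ((fun p => (p.1, p.2 + w.2 * p.1)) \o (fun p => (p.1 + a * p.2, p.2)))).
    apply: area_preserving_comp; first exact: area_preserving_hshear.
    apply: area_preserving_comp; last exact: area_preserving_hshear.
    exact: area_preserving_vshear.
  have aw : a * w.2 = w.1 - 1 by rewrite /a mulfVK.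
  have aw1 : a * (1 + w.1) = - w.2.
    apply: (mulIf w2); rewrite mulrAC aw mulNr.
    by transitivity (w.1 * w.1 + w.2 * w.2 - 1 - w.2 * w.2); [|rewrite w1];
      ring.
  apply/funext => -[x y]; rewrite frameE /=; congr pair.
    transitivity ((1 + a * w.2) * x + a * (1 + (1 + a * w.2)) * y);
      last by ring.
    by rewrite aw addrCA subrr addr0 aw1 mulNr.
  transitivity (w.2 * x + (1 + a * w.2) * y); last by ring.
  by rewrite aw addrCA subrr addr0.
have [u2|] := eqVneq u.2 0; last exact: main.
rewrite (_ : frame u = frame (0, 1) \o frame (u.2, - u.1)).
  apply: area_preserving_comp; apply: main => /=.
  - by rewrite mul0r mulr1 add0r.
  - exact: oner_neq0.
  - by rewrite mulrNN addrC.
  - rewrite oppr_eq0; apply/eqP => u10.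
    by move: u1; rewrite u2 u10 mul0r addr0 => /esym/eqP; rewrite oner_eq0.
by apply/funext => -[x y]; rewrite /= !frameE /=; congr pair; ring.
Qed.

Lemma closed_measurable_plane (R : realType) (E : set (plane R)) :
  closed E -> measurable (E : set (mplane R)).
Proof.
move=> cE; rewrite -(setCK E); apply: measurableC.
by apply: open_measurable_plane; exact: closed_openC.
Qed.

Lemma compact_measurable_plane (R : realType) (E : set (plane R)) :
  compact E -> measurable (E : set (mplane R)).
Proof.
by move=> cE; apply: closed_measurable_plane; exact: compact_closed.
Qed.

Lemma lambda2_itv (R : realType) (i j : interval R) :
  lambda2 ([set` i] `*` [set` j]) =
  (lebesgue_measure ([set` i] : set R) * lebesgue_measure ([set` j] : set R))%E.
Proof. by rewrite [LHS]product_measure1E//; exact: measurable_itv. Qed.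

Lemma lambda2_mono (R : realType) (E F : set (plane R)) :
  measurable (E : set (mplane R)) -> measurable (F : set (mplane R)) ->
  E `<=` F -> (lambda2 E <= lambda2 F)%E.
Proof.
exact: (@measure_mono _ (mplane R) R
  [the measure _ _ of (@lebesgue_measure R \x @lebesgue_measure R)%E]).
Qed.

Lemma compact_plane_bounded (R : realType) (E : set (plane R)) :
  compact E -> exists M : R, forall p, E p -> `|p.1| <= M /\ `|p.2| <= M.
Proof.
move=> /compact_bounded [M [_ bE]].
exists (`|M| + 1) => p /(bE (`|M| + 1)) /=;
  rewrite (le_lt_trans (ler_norm _)) ?ltrDl// => /(_ erefl).
by rewrite prod_normE/= ge_max => /andP.
Qed.

Lemma compact_lambda2_lty (R : realType) (E : set (plane R)) :
  compact E -> (lambda2 E < +oo)%E.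
Proof.
move=> cE; have [M EM] := compact_plane_bounded cE.
pose Q : set (mplane R) := `[- M, M] `*` `[- M, M].
have mQ : measurable Q by apply: measurableX; exact: measurable_itv.
apply: (@le_lt_trans _ _ (lambda2 Q)).
  apply: lambda2_mono => //.
    exact: compact_measurable_plane.
  by move=> p /EM[]; rewrite /Q/= !in_itv/= !ler_norml.
by rewrite lambda2_itv lebesgue_measure_itv/=; case: ifP => _;
  rewrite ?mule0 -?EFinM ltry.
Qed.

Lemma nbhs_lambda2_gt0 (R : realType) (E : set (plane R)) (p : plane R) :
  measurable (E : set (mplane R)) -> nbhs p E -> (0 < lambda2 E)%E.
Proof.
move=> mE /nbhs_ballP[e /= e0 eE].
pose Q : set (mplane R) := `]p.1 - e, p.1 + e[ `*` `]p.2 - e, p.2 + e[.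
have mQ : measurable Q by apply: measurableX; exact: measurable_itv.
apply: (@lt_le_trans _ _ (lambda2 Q)).
  rewrite lambda2_itv !lebesgue_measure_itv/= !lte_fin !ifT; [|lra|lra].
  by rewrite -!EFinB -EFinM lte_fin mulr_gt0//; lra.
apply: lambda2_mono => //.
move=> [x y] []; rewrite /= !in_itv/= => xa yb; apply: eE.
by split; rewrite /ball/= ltr_norml; lra.
Qed.

(* The section of [E] by the line through [t *: rot90 u] parallel to [u], in the
   arc-length coordinate of that line. *)
Definition slice (R : realType) (u : plane R) (E : set (plane R)) (t : R) :
  set R := [set s | E (frame u (s, t))].

Lemma continuous_frame (R : realType) (u : plane R) : continuous (frame u).
Proof.
move=> p; rewrite /frame; apply: cvgD; apply: cvgZr_tmp.
  exact: cvg_fst.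
exact: cvg_snd.
Qed.

Lemma slice_closed (R : realType) (u : plane R) (E : set (plane R)) (t : R) :
  closed E -> closed (slice u E t).
Proof.
move=> cE; apply: (@preimage_closed _ _ (fun s => frame u (s, t))) => // s _.
rewrite /frame/=; apply: cvgD; last exact: cvg_cst.
by apply: cvgZr_tmp; exact: cvg_id.
Qed.

Lemma dot_frame (R : realType) (u p : plane R) : unit_circle u ->
  dot (frame u p) u = p.1 /\ dot (frame u p) (rot90 u) = p.2.
Proof.
rewrite /unit_circle /= => hu; rewrite frameE /dot/=; split.
  by rewrite -[RHS]mul1r -hu /dot; ring.
by rewrite -[RHS]mul1r -hu /dot; ring.
Qed.

Lemma slice_bounded (R : realType) (u : plane R) (E : set (plane R)) :
  unit_circle u -> compact E -> forall t,
  has_lbound (slice u E t) /\ has_ubound (slice u E t).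
Proof.
move=> hu /compact_plane_bounded[M EM] t.
have b s : slice u E t s -> `|s| <= M * `|u.1| + M * `|u.2|.
  move=> /EM[p1 p2]; have [/= <- _] := dot_frame (s, t) hu.
  rewrite /dot; apply: le_trans (ler_normD _ _) _; rewrite !normrM.
  by rewrite lerD// ler_wpM2r.
split; [exists (- (M * `|u.1| + M * `|u.2|))|exists (M * `|u.1| + M * `|u.2|)].
  by move=> s /b; rewrite ler_norml => /andP[].
by move=> s /b; rewrite ler_norml => /andP[].
Qed.

Lemma sliceE (R : realType) (u : plane R) (E : set (plane R)) (t : R) :
  slice u E t = ysection (frame u @^-1` E) t.
Proof.
apply/seteqP; split => s; rewrite /slice/= /ysection/=; last exact: set_mem.
by move=> h; exact: mem_set.
Qed.

Lemma lambda2_slice (R : realType) (u : plane R) (E : set (plane R)) :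
  unit_circle u -> measurable (E : set (mplane R)) ->
  lambda2 E = (\int[lebesgue_measure]_t lebesgue_measure (slice u E t))%E.
Proof.
move=> hu mE; have [mf <-] := area_preserving_frame hu mE.
by rewrite lambda2_ysection//; apply: eq_integral => t _; rewrite sliceE.
Qed.

Lemma measurable_fun_slice (R : realType) (u : plane R) (E : set (plane R)) :
  unit_circle u -> measurable (E : set (mplane R)) ->
  measurable_fun setT (fun t : measurableTypeR R =>
    lebesgue_measure (slice u E t)).
Proof.
move=> hu mE; have [mf _] := area_preserving_frame hu mE.
under eq_fun do rewrite sliceE.
exact: (measurable_fun_ysection (@lebesgue_measure R) mf).
Qed.

Lemma slice_translate (R : realType) (u : plane R) (E : set (plane R))
    (r t : R) :
  slice u [set a + r *: u | a in E] t = (fun s => s - r) @^-1` slice u E t.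
Proof.
have fr s : frame u (s - r, t) = frame u (s, t) - r *: u.
  by rewrite /frame/= scalerBl addrAC.
apply/seteqP; split => s; rewrite /slice/= fr.
  by move=> [a Ea <-]; rewrite addrK.
by move=> h; exists (frame u (s, t) - r *: u) => //; rewrite subrK.
Qed.

(** * The derivative of the covariogram at the origin *)

Lemma translateE (R : realType) (E : set (plane R)) (x : plane R) :
  [set a + x | a in E] = (fun p => p - x) @^-1` E.
Proof.
apply/seteqP; split => p /=; first by move=> [a Ea <-]; rewrite addrK.
by move=> Ep; exists (p - x) => //; rewrite subrK.
Qed.

Lemma compact_measurable_translate (R : realType) (E : set (plane R))
    (x : plane R) :
  compact E -> measurable ([set a + x | a in E] : set (mplane R)).
Proof.
move=> cE; apply: closed_measurable_plane; rewrite translateE.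
apply: preimage_closed; last exact: compact_closed.
by move=> p _; apply: cvgB; [exact: cvg_id|exact: cvg_cst].
Qed.

Lemma covariogram0 (R : realType) (A : set (plane R)) :
  covariogram A 0 = lambda2 A.
Proof.
rewrite /covariogram translateE (_ : _ @^-1` A = A) ?setIid//.
by apply/seteqP; split=> p /=; rewrite subr0.
Qed.

Lemma covariogram0B (R : realType) (A : set (plane R)) (x : plane R) :
  compact A ->
  lambda2 (A `\` [set a + x | a in A]) =
    (covariogram A 0%R - covariogram A x)%E.
Proof.
move=> cA; rewrite covariogram0; apply: (@measureD _ (mplane R) R
  [the measure _ _ of (@lebesgue_measure R \x @lebesgue_measure R)%E]).
- exact: compact_measurable_plane.
- exact: compact_measurable_translate.
- exact: compact_lambda2_lty.
Qed.

(** * Limits of counts and of their integrals *)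

Lemma near_right_natSinv (R : realType) (P : R -> Prop) :
  (\forall r \near 0^'+, P r) -> \forall n \near \oo, P n.+1%:R^-1.
Proof.
move=> [e /= e0 eP]; near=> n; apply: eP; last by rewrite /= invr_gt0.
rewrite /= sub0r normrN gtr0_norm ?invr_gt0//.
by near: n; exact: near_infty_natSinv_lt (PosNum e0).
Unshelve. all: by end_near. Qed.

(** A finite count is itself an admissible [k], so [f] is eventually equal to it; an infinite count
    makes every [k] an eventual lower bound. *)
Lemma cvg_counting (R : realType) (T : choiceType) (I : set T)
    (f : (\bar R)^nat) :
  (forall n, (f n <= counting I)%E) ->
  (forall k : nat, (k%:R%:E <= @counting T R I)%E ->
    \forall n \near \oo, (k%:R%:E <= f n)%E) ->
  f @ \oo --> @counting T R I.
Proof.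
rewrite /counting; case: asboolP => [fI|iI] fle lef.
  apply: cvg_near_cst; near=> n; apply/eqP; rewrite eq_le fle/=.
  by near: n; exact: lef.
apply/cvgeyPge => M.
near=> n; apply: (@le_trans _ _ (Num.truncn `|M|).+1%:R%:E).
  by rewrite lee_fin (le_trans (ler_norm _))// ltW// truncnS_gt.
by near: n; apply: lef; rewrite leey.
Unshelve. all: by end_near. Qed.

(** Domination by the limit bounds the integrals above and Fatou's lemma bounds them below, so [g]
    may have infinite integral. Measurability of [g] comes from the pointwise limit; this is how the
    segment count is shown measurable. *)
Lemma cvg_integral_le d (T : measurableType d) (R : realType)
    (mu : {measure set T -> \bar R}) (f : (T -> \bar R)^nat) (g : T -> \bar R) :
  (forall n, measurable_fun setT (f n)) -> (forall n x, (0 <= f n x)%E) ->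
  (forall n x, (f n x <= g x)%E) -> (forall x, f n x @[n --> \oo] --> g x) ->
  measurable_fun setT g /\
  (\int[mu]_x f n x)%E @[n --> \oo] --> (\int[mu]_x g x)%E.
Proof.
move=> mf f0 fg cf.
have mg : measurable_fun setT g by apply: (emeasurable_fun_cvg f) => // x _;
  exact: cf.
have g0 x : (0 <= g x)%E by exact: le_trans (f0 0%N x) (fg 0%N x).
split => //.
have ub n : (\int[mu]_x f n x <= \int[mu]_x g x)%E.
  by apply: ge0_le_integral => // x _; exact: fg.
have lb : (\int[mu]_x g x <= limn_einf (fun n => \int[mu]_x f n x))%E.
  rewrite [leLHS](_ : _ = \int[mu]_x limn_einf (f^~ x))%E; last first.
    by apply: eq_integral => x _; have [->] := cvg_limn_einf_sup (cf x).
  exact: fatou.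
have cinf := @is_cvg_einfs _ (fun n => \int[mu]_x f n x)%E.
(* The integrals lie between their tail infima, which tend to the lower limit, and the constant
   integral of [g]. *)
apply: (@squeeze_cvge _ _ _ _ (einfs (fun n => \int[mu]_x f n x)%E)
  _ (cst (\int[mu]_x g x)%E)); last exact: cvg_cst.
  apply: nearW => n; rewrite ub andbT.
  by apply: ereal_inf_lbound; exists n => /=.
apply/cvg_closeP; split => //; rewrite closeE//; apply/eqP.
rewrite eq_le -limn_einf_lim lb andbT limn_einf_lim.
apply: lime_le => //; apply: nearW => n; apply: le_trans (ub n).
by apply: ereal_inf_lbound; exists n => /=.
Qed.

(* [L t C], for [C] in [I t], are the non-degenerate components of the section
   at [t]; abstracting the index type covers both [A] and convex bodies. *)
Lemma slice_counting_cvg (R : realType) (u : plane R) (A : set (plane R))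
    (T : choiceType) (I : R -> set T) (L : R -> T -> set R) :
  unit_circle u -> compact A ->
  (forall t C, I t C -> is_interval (L t C)) ->
  (forall t C, I t C -> L t C `<=` slice u A t) ->
  (forall t, lebesgue_measure (slice u A t `\` \bigcup_(C in I t) L t C) =
    0%E) ->
  (forall t C, I t C -> exists z e, 0 < e /\ `[z - e, z] `<=` L t C) ->
  (forall t C C' z z', I t C -> I t C' -> C <> C' -> L t C z -> L t C' z' ->
    z' <= z -> exists q, [/\ z' < q, q < z & ~ slice u A t q]) ->
  measurable_fun setT (fun t : measurableTypeR R => @counting T R (I t)) /\
  (n.+1%:R%:E * (covariogram A 0%R - covariogram A (n.+1%:R^-1 *: u)))%E
    @[n --> \oo] -->
    (\int[lebesgue_measure]_t @counting T R (I t))%E.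
Proof.
move=> hu cA iL LS S0 nL gL.
pose D (r : R) : set (plane R) := A `\` [set a + r *: u | a in A].
(* This is the difference quotient of the section at [t] for [r = 1 / (n + 1)]; its integral is that
   of the covariogram. *)
pose f n (t : measurableTypeR R) :=
  (n.+1%:R%:E * lebesgue_measure (slice u (D n.+1%:R^-1%R) t))%E.
have mD r : measurable (D r : set (mplane R)).
  apply: measurableD; first exact: compact_measurable_plane.
  exact: compact_measurable_translate.
have DE r t : slice u (D r) t =
    slice u A t `\` (fun s => s - r) @^-1` slice u A t.
  by rewrite -slice_translate.
have cS t : closed (slice u A t) by apply: slice_closed; exact: compact_closed.
have mS t : measurable (slice u A t : set R) by exact: closed_measurable.
have mf n : measurable_fun setT (f n).
  by apply: measurable_funeM; exact: measurable_fun_slice.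
have inv_gt0 n : 0 < n.+1%:R^-1 :> R by rewrite invr_gt0.
have n1_ge0 n : (0 <= n.+1%:R%:E :> \bar R)%E by rewrite lee_fin.
have fg n t : (f n t <= counting (I t))%E.
  have [lS uS] := slice_bounded hu cA t.
  rewrite /f DE.
  have := shift_difference_le_counting (mS t) lS (inv_gt0 n) (iL t) (LS t)
    (S0 t).
  move=> /(lee_wpmul2l (n1_ge0 n)).
  by rewrite muleA -EFinM divff// mul1e.
have [] := @cvg_integral_le _ _ R (@lebesgue_measure R) f (fun t =>
  counting (I t)) mf.
- by move=> n t; apply: mule_ge0.
- exact: fg.
- move=> t; apply: cvg_counting => [n|k kI]; first exact: fg.
  have [lS uS] := slice_bounded hu cA t.
  have := near_right_natSinv (shift_difference_ge_counting (cS t) lS uS (LS t)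
    (nL t) (gL t) kI).
  apply: filterS => n; rewrite /f DE.
  move=> /(lee_wpmul2l (n1_ge0 n)).
  by rewrite -EFinM mulrCA divff// mulr1.
move=> mg; split => //.
rewrite (_ : (fun n => _) = fun n => (\int[lebesgue_measure]_t f n t)%E)//.
apply/funext => n; rewrite ge0_integralZl//.
  by rewrite -covariogram0B// (lambda2_slice hu (mD _)).
exact: measurable_fun_slice.
Qed.

Lemma convex_setP (R : realType) (M : lmodType R) (E : set M) :
  convex_set E <-> (forall p q l,
    E p -> E q -> 0 <= l <= 1 -> E (l *: p + (1 - l) *: q)).
Proof.
split=> [cE p q l Ep Eq /andP[l0 l1]|cE p q l /set_mem Ep /set_mem Eq].
  by have := cE p q (Itv01 l0 l1) (mem_set Ep) (mem_set Eq) => /set_mem.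
by apply/mem_set; apply: cE => //; apply/andP.
Qed.

Lemma continuous_dot (R : realType) (v : plane R) :
  continuous (fun p : plane R => dot p v : R^o).
Proof.
move=> p; rewrite /dot; apply: cvgD.
  by apply: cvgM; [exact: cvg_fst|exact: cvg_cst].
by apply: cvgM; [exact: cvg_snd|exact: cvg_cst].
Qed.

Lemma dotD (R : realType) (p q v : plane R) : dot (p + q) v = dot p v + dot q v.
Proof. by rewrite /dot/=; ring. Qed.

Lemma dotN (R : realType) (p v : plane R) : dot (- p) v = - dot p v.
Proof. by rewrite /dot/=; ring. Qed.

Lemma dotZ (R : realType) (l : R) (p v : plane R) :
  dot (l *: p) v = l * dot p v.
Proof. by rewrite /dot /= /GRing.scale/=; ring. Qed.

Lemma frame_dot (R : realType) (u p : plane R) : unit_circle u ->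
  frame u (dot p u, dot p (rot90 u)) = p.
Proof.
rewrite /unit_circle/= => hu; rewrite frameE /dot/=; case: p => x y /=.
congr pair; rewrite -[RHS]mul1r -hu /dot; ring.
Qed.

Lemma orth_rot90 (R : realType) (u : plane R) (t : R) : orth u (t *: rot90 u).
Proof. by rewrite /orth/= dotZ /dot/=; ring. Qed.

(** * Chords and their non-degenerate components *)

Lemma chordP (R : realType) (A : set (plane R)) (u : plane R) (t : R)
    (p : plane R) :
  unit_circle u ->
  chord A u (t *: rot90 u) p <-> A p /\ dot p (rot90 u) = t.
Proof.
move=> hu; split=> [[Ap [s _ sp]]|[Ap <-]].
  by split => //; rewrite -sp addrC; have [_] := dot_frame (s, t) hu.
split => //; exists (dot p u) => //; rewrite -[RHS](frame_dot p hu) /frame/=.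
exact: addrC.
Qed.

Lemma slice_chord (R : realType) (A : set (plane R)) (u : plane R) (t : R) :
  unit_circle u -> slice u (chord A u (t *: rot90 u)) t = slice u A t.
Proof.
move=> hu; apply/seteqP; split => s; rewrite /slice/=.
  by move=> /(chordP _ _ _ hu)[].
by move=> As; apply/chordP => //; split => //; have [_] := dot_frame (s, t) hu.
Qed.

(** On a single line parallel to [u], the slice is the image of [C] under the continuous map
    [dot _ u]. *)
Lemma slice_connected (R : realType) (C : set (plane R)) (u : plane R) (t : R) :
  unit_circle u -> (forall p, C p -> dot p (rot90 u) = t) ->
  connected C -> is_interval (slice u C t).
Proof.
move=> hu Ct cC; apply/connected_intervalP.
rewrite (_ : slice u C t = (fun p => dot p u) @` C).
  apply: connected_continuous_connected => //.
  by apply: continuous_subspaceT; exact: continuous_dot.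
apply/seteqP; split => s /=.
  by move=> Cs; exists (frame u (s, t)) => //; have [] := dot_frame (s, t) hu.
by move=> [p Cp <-]; rewrite /slice/= -(Ct p Cp) frame_dot.
Qed.

Lemma connected_frame_itv (R : realType) (u : plane R) (t a b : R) :
  connected ((fun s => frame u (s, t)) @` `[a, b]).
Proof.
apply: connected_continuous_connected; first exact: segment_connected.
apply: continuous_subspaceT => s; rewrite /frame/=.
by apply: cvgD; [apply: cvgZr_tmp; exact: cvg_id|exact: cvg_cst].
Qed.

Lemma nondegenerate_componentP (R : realType) (S C : set (plane R)) p :
  nondegenerate_components S C -> C p -> C = connected_component S p.
Proof.
by move=> [[x Sx ->] _] xp; apply: same_connected_component.
Qed.

Lemma nondegenerate_component_sub (R : realType) (S C : set (plane R)) :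
  nondegenerate_components S C -> C `<=` S.
Proof. by move=> [[x Sx ->] _]; exact: connected_component_sub. Qed.

Lemma nondegenerate_component_connected (R : realType) (S C : set (plane R)) :
  nondegenerate_components S C -> connected C.
Proof. by move=> [[x Sx ->] _]; exact: component_connected. Qed.

Lemma segment_number_cvg (R : realType) (u : plane R) (A : set (plane R)) :
  unit_circle u -> compact A ->
  (forall y, orth u y ->
     lambda1 y u
       (chord A u y `+`
        \bigcup_(C in nondegenerate_components (chord A u y)) C) = 0%E) ->
  measurable_fun setT
    (fun t : measurableTypeR R => segment_number A u (t *: rot90 u)) /\
  (n.+1%:R%:E * (covariogram A 0%R - covariogram A (n.+1%:R^-1 *: u)))%E
    @[n --> \oo] -->
    (\int[lebesgue_measure]_t segment_number A u (t *: rot90 u))%E.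
Proof.
move=> hu cA hs.
pose I t := nondegenerate_components (chord A u (t *: rot90 u)).
pose L t C := slice u C t.
have Idot t C p : I t C -> C p -> dot p (rot90 u) = t.
  by move=> /nondegenerate_component_sub IC /IC/(chordP _ _ _ hu)[].
have iL t C : I t C -> is_interval (L t C).
  move=> IC; apply: slice_connected => //; first by move=> p; exact: Idot.
  exact: nondegenerate_component_connected IC.
have LS t C : I t C -> L t C `<=` slice u A t.
  by move=> /nondegenerate_component_sub IC s /IC;
    rewrite -(slice_chord _ _ hu).
apply: (@slice_counting_cvg R u A _ I L) => //.
(* Components lie inside the chord, so the symmetric difference in the hypothesis reduces to a
   one-sided one. *)
- move=> t; rewrite -[RHS](hs _ (orth_rot90 u t)); congr lebesgue_measure.
  apply/seteqP; split => s /=.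
    move=> [Ss Us]; left; split.
      by rewrite addrC; move: Ss; rewrite -slice_chord.
    by move=> [C IC Cs]; apply: Us; exists C => //;
      rewrite /L /slice/= /frame addrC.
  move=> [[Ss Us]|[[C IC Cs] nS]]; last first.
    by case: nS; exact: nondegenerate_component_sub IC _ Cs.
  split; first by rewrite -(slice_chord _ _ hu) /slice/= /frame addrC.
  by move=> [C IC Cs]; apply: Us; exists C => //; move: Cs;
    rewrite /L /slice/= /frame addrC.
(* Two distinct points of [C] have the same [rot90 u] coordinate, hence different [u] coordinates,
   and connectedness fills the segment between them. *)
- move=> t C IC; have [_ [p [q [Cp Cq pq]]]] := IC.
  wlog pqs : p q Cp Cq pq / dot p u <= dot q u.
    move=> W; have [|/ltW] := leP (dot p u) (dot q u); first exact: W.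
    by apply: W => // /esym.
  have Lp x : C x -> L t C (dot x u).
    by move=> Cx; rewrite /L /slice/= -(Idot _ _ _ IC Cx) frame_dot.
  have lt_pq : dot p u < dot q u.
    rewrite lt_neqAle pqs andbT; apply/eqP => e; apply: pq.
    by rewrite -(frame_dot p hu) -(frame_dot q hu) e (Idot _ _ _ IC Cp)
      (Idot _ _ _ IC Cq).
  exists (dot q u), (dot q u - dot p u); split; first by rewrite subr_gt0.
  rewrite opprB addrCA subrr addr0 => x; rewrite /= in_itv/= => xpq.
  by apply: (iL t C IC _ _ (Lp p Cp) (Lp q Cq)).
(* Without a gap the whole segment from [z'] to [z] would lie in the chord and merge the two
   components. *)
- move=> t C C' z z' IC IC' CC' Lz Lz' zz'.
  apply: contrapT => /forallNP ng; apply: CC'.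
  have sub : `[z', z] `<=` slice u A t.
    move=> q /=; rewrite in_itv/= => /andP[zq qz]; apply: contrapT => nq.
    have [e|nz] := eqVneq q z; first by apply: nq; rewrite e; exact: LS IC _ Lz.
    have [e|nz'] := eqVneq q z'; first by apply: nq; rewrite e;
      exact: LS IC' _ Lz'.
    by apply: (ng q); split => //; rewrite lt_neqAle ?zq ?qz andbT// eq_sym.
  rewrite (nondegenerate_componentP IC Lz) (nondegenerate_componentP IC' Lz').
  apply/same_connected_component.
  exists ((fun s => frame u (s, t)) @` `[z', z]); last first.
    by exists z' => //=; rewrite in_itv/= lexx.
  split; first by exists z => //=; rewrite in_itv/= lexx zz'.
    move=> _ [s /sub + <-]; by rewrite -(slice_chord _ _ hu).
  exact: connected_frame_itv.
Qed.

(** * Widths and convex bodies *)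

(** The homothety with centre [p] and ratio [l] maps a ball around [i] in [K] to a ball in [K]. *)
Lemma convex_interior (R : realType) (K : set (plane R)) (i p : plane R)
    (l : R) :
  convex_set K -> K° i -> K p -> 0 < l -> l <= 1 -> K° (l *: i + (1 - l) *: p).
Proof.
move=> /convex_setP cK /nbhs_ballP[e /= e0 eK] Kp l0 l1.
apply/nbhs_ballP; exists (l * e); first exact: mulr_gt0.
move=> q; rewrite -ball_normE/= => qe.
set x := l *: i + _ in qe *.
rewrite (_ : q = l *: (i + l^-1 *: (q - x)) + (1 - l) *: p); last first.
  by rewrite scalerDr scalerA divff ?gt_eqF// scale1r addrAC -/x addrCA subrr
    addr0.
apply: cK => //; last by rewrite ltW.
apply: eK; rewrite -ball_normE/= opprD addNKr normrN normrZ gtr0_norm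
  ?invr_gt0//.
by rewrite mulrC ltr_pdivrMr// mulrC distrC.
Qed.

(** Points on the segment from [p] to an interior point are interior and tend to [p]. Thus
    [covariogram_width] also applies with the roles of [A] and [K] exchanged. *)
Lemma convex_closure_interior (R : realType) (K : set (plane R)) :
  convex_set K -> K° !=set0 -> K `<=` closure K°.
Proof.
move=> cK [i iK] p Kp B pB.
have cvg : (fun l : R => l *: i + (1 - l) *: p) l @[l --> 0^'+] --> p.
  apply: cvg_at_right_filter.
  rewrite -[X in _ --> X](_ : 0 *: i + (1 - 0) *: p = p); last first.
    by rewrite scale0r subr0 scale1r add0r.
  apply: cvgD; apply: cvgZr_tmp; first exact: cvg_id.
  by apply: cvgB; [exact: cvg_cst|exact: cvg_id].
near (0 : R)^'+ => l; exists (l *: i + (1 - l) *: p); split.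
  apply: convex_interior => //.
  by near: l; exact: nbhs_right_le.
by near: l; exact: cvg pB.
Unshelve. all: by end_near. Qed.

Lemma interior_dot_gt (R : realType) (E : set (plane R)) (v p : plane R)
    (a : R) :
  E `<=` closure E° -> E p -> a < dot p v -> exists2 q, E° q & a < dot q v.
Proof.
move=> EE Ep ap; have [] := EE p Ep [set q | a < dot q v].
  exact: (@continuous_dot R v p _ (lt_nbhsr ap)).
by move=> q [Eq aq]; exists q.
Qed.

(* If [p] and [q] were farther apart in direction [v] than any two points of
   [K], interior points near them would give a vector at which the covariogram
   of [A] is positive but that of [K] vanishes. *)
Lemma covariogram_width (R : realType) (A K : set (plane R)) (v : plane R)
    (w : R) :
  compact A -> A `<=` closure A° -> covariogram A = covariogram K ->
  (forall x y, K x -> K y -> dot x v - dot y v <= w) ->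
  forall p q, A p -> A q -> dot p v - dot q v <= w.
Proof.
move=> cA AA gAK Kw p q Ap Aq; rewrite leNgt; apply/negP => wpq.
(* Half the excess over [w] is the loss allowed at each of the two points. *)
pose e := (dot p v - dot q v - w) / 2.
have e0 : 0 < e by rewrite divr_gt0// subr_gt0.
have ew : dot p v - dot q v - w = e + e by rewrite /e -splitr.
have [p' p'A pp'] : exists2 p', A° p' & dot p v - e < dot p' v.
  by apply: (interior_dot_gt AA Ap); rewrite ltrBlDr ltrDl.
have [q' q'A qq'] : exists2 q', A° q' & dot q (- v) - e < dot q' (- v).
  by apply: (interior_dot_gt AA Aq); rewrite ltrBlDr ltrDl.
have dN x : dot x (- v) = - dot x v by rewrite /dot/=; ring.
rewrite !dN in qq'.
pose x := p' - q'.
have wx : w < dot x v by rewrite /x dotD dotN; lra.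
(* [p'] is interior to [A] and, since [p' - x = q'], also to [A + x]. *)
have : (0 < covariogram A x)%E.
  apply: (@nbhs_lambda2_gt0 R _ p').
    apply: measurableI; first exact: compact_measurable_plane.
    exact: compact_measurable_translate.
  apply: filterI; first exact: p'A.
  rewrite translateE.
  have cx : (y - x) @[y --> p'] --> p' - x.
    by apply: cvgB; [exact: cvg_id|exact: cvg_cst].
  by apply: cx; rewrite /x opprB addrCA subrr addr0.
rewrite gAK /covariogram (_ : K `&` _ = set0).
  by rewrite /lambda2 [X in (_ < X)%E]measure0 ltxx.
rewrite -subset0 => y [Ky [z Kz zxy]].
by have := Kw y z Ky Kz; rewrite -zxy dotD; lra.
Qed.

Lemma convex_slice_interval (R : realType) (K : set (plane R))
    (u : plane R) (t : R) :
  convex_set K -> is_interval (slice u K t).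
Proof.
move=> /convex_setP cK a b Ka Kb c /andP[]; rewrite !le_eqVlt.
move=> /predU1P[<-//|ac] /predU1P[->//|cb].
pose l := (b - c) / (b - a).
have ba : 0 < b - a by rewrite subr_gt0 (lt_trans ac).
have l01 : 0 <= l <= 1.
  by apply/andP; split; rewrite /l ?ler_pdivrMr ?divr_ge0// ?subr_ge0 ?(ltW cb)
    ?(ltW ba)//; lra.
have := cK _ _ l Ka Kb l01; rewrite /slice/=; congr K.
rewrite /frame/= !scalerDr !scalerA addrACA -!scalerDl; congr (_ *: _ + _ *: _).
  have lba : l * (b - a) = b - c by rewrite mulfVK ?gt_eqF.
  transitivity (b - l * (b - a)); first by ring.
  by rewrite lba; ring.
by rewrite addrCA subrr addr0 scale1r.
Qed.

(** With [p] and [q] replaced by nearby interior points still on either side of level [t], the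
    segment joining them crosses that level at an interior point of [K]. *)
Lemma convex_slice_nondegenerate (R : realType) (K : set (plane R))
    (u p q : plane R) (t : R) :
  unit_circle u -> convex_set K -> K° !=set0 -> K p -> K q ->
  dot p (rot90 u) < t -> t < dot q (rot90 u) ->
  exists a b, [/\ a < b, slice u K t a & slice u K t b].
Proof.
move=> hu cK Ki Kp Kq pt tq; have KK := convex_closure_interior cK Ki.
set v := rot90 u in pt tq *.
have dN x : dot x (- v) = - dot x v by rewrite /dot/=; ring.
have [p' p'K] : exists2 p', K° p' & - t < dot p' (- v).
  by apply: (interior_dot_gt KK Kp); rewrite dN ltrN2.
rewrite dN ltrN2 => p't.
have [q' q'K tq'] := interior_dot_gt KK Kq tq.
pose l := (dot q' v - t) / (dot q' v - dot p' v).
have d0 : 0 < dot q' v - dot p' v by lra.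
have l0 : 0 < l by rewrite divr_gt0// subr_gt0.
have l1 : l <= 1 by rewrite ler_pdivrMr// mul1r; lra.
have := convex_interior cK p'K (interior_subset q'K) l0 l1.
set m := _ + _ => mK.
have mt : dot m v = t.
  rewrite /m dotD !dotZ.
  have lba : l * (dot q' v - dot p' v) = dot q' v - t by rewrite mulfVK ?gt_eqF.
  transitivity (dot q' v - l * (dot q' v - dot p' v)); first by ring.
  by rewrite lba; ring.
have cf : (fun s => frame u (s, t)) s @[s --> dot m u] --> m.
  rewrite -[X in _ --> X](frame_dot m hu) -/v mt /frame/=.
  by apply: cvgD; [apply: cvgZr_tmp; exact: cvg_id|exact: cvg_cst].
have /nbhs_ballP[e /= e0 eK] := cf _ mK.
exists (dot m u), (dot m u + e / 2); split.
- by rewrite ltrDl divr_gt0.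
- by apply: eK; exact: ballxx.
- by apply: eK; rewrite /ball/= opprD addNKr normrN gtr0_norm ?divr_gt0//
  gtr_pMr// invf_lt1// ltr1n.
Qed.

(* A section of a convex set has at most one non-degenerate component; the
   set of these is indexed by [unit]. *)
Definition nondegenerate (R : realType) (S : set R) : set unit :=
  [set _ | exists a b, [/\ a < b, S a & S b]].

Lemma convex_slice_cvg (R : realType) (u : plane R) (K : set (plane R)) :
  unit_circle u -> compact K -> convex_set K ->
  measurable_fun setT (fun t : measurableTypeR R =>
    @counting _ R (nondegenerate (slice u K t))) /\
  (n.+1%:R%:E * (covariogram K 0%R - covariogram K (n.+1%:R^-1 *: u)))%E
    @[n --> \oo] -->
    (\int[lebesgue_measure]_t @counting _ R (nondegenerate (slice u K t)))%E.
Proof.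
pose I t := nondegenerate (slice u K t).
move=> hu cK vK.
apply: (@slice_counting_cvg R u K _ I (fun t _ => slice u K t)) => //.
- by move=> t _ _; exact: convex_slice_interval.
- by move=> t C _ s.
(* A section without two distinct points is empty or a singleton, hence null. *)
- move=> t; have [[c Ic]|nI] := pselect (exists c, I t c).
    suff -> : slice u K t `\` \bigcup_(C in I t) slice u K t = set0
      by rewrite measure0.
    by rewrite -subset0 => s [Ks]; apply; exists c.
  rewrite bigcup0 ?setD0 => [|c Ic]; last by case: nI; exists c.
  have [->|/set0P[a Ka]] := eqVneq (slice u K t) set0;
    first by rewrite measure0.
  rewrite (_ : slice u K t = [set a]) ?lebesgue_measure_set1//.
  apply/seteqP; split => [b Kb /=|_ ->//]; apply/eqP;
    apply: contra_notT nI => ab.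
  exists tt; have [?|?|e] := ltgtP a b; [by exists a, b|by exists b, a|].
  by rewrite e eqxx in ab.
- move=> t c [a [b [ab Ka Kb]]]; exists b, (b - a);
  split; first by rewrite subr_gt0.
  rewrite opprB addrCA subrr addr0 => x; rewrite /= in_itv/= => xab.
  exact: (convex_slice_interval vK Ka Kb).
- by move=> t [] [].
Qed.

(** * Projections, level sets of the count, and the conclusion *)

Lemma dot_extrema (R : realType) (A : set (plane R)) (v : plane R) :
  compact A -> A !=set0 ->
  exists p q, [/\ A p, A q & forall x, A x -> dot p v <= dot x v <= dot q v].
Proof.
move=> cA A0; have cd : {within A, continuous (fun p => dot p v)}.
  by apply: continuous_subspaceT; exact: continuous_dot.
have [p /set_mem Ap minp] := compact_EVT_min A0 cA cd.
have [q /set_mem Aq maxq] := compact_EVT_max A0 cA cd.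
by exists p, q; split => // x /mem_set Ax; rewrite minp// maxq.
Qed.

(** The strip between the extreme values is convex and contains the projection; conversely each
    level in between is a convex combination of the projections of [p] and [q]. *)
Lemma convex_hull_proj (R : realType) (A : set (plane R))
    (u p q : plane R) (t : R) :
  unit_circle u -> A p -> A q ->
  (forall x, A x -> dot p (rot90 u) <= dot x (rot90 u) <= dot q (rot90 u)) ->
  convex_hull (proj_orth u A) (t *: rot90 u) <->
  dot p (rot90 u) <= t <= dot q (rot90 u).
Proof.
move=> hu Ap Aq pq; set v := rot90 u in pq *.
have projE x : x - dot x u *: u = dot x v *: v.
  by rewrite -[X in X - _](frame_dot x hu) /frame/= addrAC subrr add0r.
have vv : dot v v = 1 by move: hu; rewrite /unit_circle/= /dot/= => <-; ring.
split=> [hull|/andP[pt tq] C [cC AC]].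
  suff : [set y | dot p v <= dot y v <= dot q v] (t *: v)
    by rewrite /= dotZ vv mulr1.
  apply: hull; split.
    apply/convex_setP => x y l /andP[px xq] /andP[py yq] /andP[l0 l1].
    rewrite /= dotD !dotZ; apply/andP; split; nra.
  by move=> _ [x Ax <-]; rewrite /= projE dotZ vv mulr1; exact: pq.
move: cC => /convex_setP cC.
have Cp x : A x -> C (dot x v *: v) by move=> Ax; apply: AC; exists x.
have [e|ne] := eqVneq (dot p v) (dot q v).
  have -> : t = dot p v by lra.
  exact: Cp.
have d0 : 0 < dot q v - dot p v by rewrite subr_gt0 lt_neqAle ne (le_trans pt).
pose l := (dot q v - t) / (dot q v - dot p v).
have l01 : 0 <= l <= 1.
  by apply/andP; split; rewrite /l ?ler_pdivrMr ?divr_ge0// ?subr_ge0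
    ?(ltW d0)//; lra.
have := cC _ _ l (Cp p Ap) (Cp q Aq) l01; congr C.
rewrite !scalerA -scalerDl; congr (_ *: _).
have lba : l * (dot q v - dot p v) = dot q v - t by rewrite mulfVK ?gt_eqF.
transitivity (dot q v - l * (dot q v - dot p v)); first by ring.
by rewrite lba; ring.
Qed.

(** The integral hypothesis makes [N] integrable, so [N] is finite almost everywhere and its level
    sets exhaust [D] up to a null set. The series is then the integral of [N - 1], whose
    integrability justifies summing terms of both signs. *)
Lemma level_series_eq0 d (T : measurableType d) (R : realType)
    (mu : {measure set T -> \bar R}) (D : set T) (N : T -> \bar R) :
  measurable D -> (mu D < +oo)%E -> measurable_fun setT N ->
  (forall x, N x = +oo%E \/ exists k : nat, N x = k%:R%:E) ->
  (\int[mu]_(x in D) N x = mu D)%E ->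
  (\sum_(0 <= i <oo) ((i%:R - 1)%:E * mu (D `&` N @^-1` [set i%:R%:E])))%E =
    0%E.
Proof.
move=> mD Dfin mN Nval ND.
have N0 x : (0 <= N x)%E by have [->|[k ->]] := Nval x; rewrite ?leey// lee_fin.
have mND : measurable_fun D N by exact: measurable_funS mN.
pose F (i : nat) := D `&` N @^-1` [set i%:R%:E].
have mF i : measurable (F i).
  by rewrite /F -[N @^-1` _]setTI; apply: measurableI => //; apply: mN.
have tF : trivIset setT F.
  apply/trivIsetP => i j _ _ ij; rewrite -subset0 => x [[_ /= Ni] [_ /=]].
  by rewrite Ni => -[] /eqP; rewrite eqr_nat (negPf ij).
have iN : mu.-integrable D N.
  apply/integrableP; split => //.
  by under eq_integral do rewrite gee0_abs//; rewrite ND.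
have i1 : mu.-integrable D (cst (1%E : \bar R)).
  by apply/integrableP; split => //; under eq_integral do rewrite gee0_abs//;
    rewrite integral_cst// mul1e.
have iB : mu.-integrable D (N \- cst 1)%E by exact: integrableB.
pose Z := D `&` N @^-1` [set +oo%E].
have mZ : measurable Z.
  by rewrite /Z -[N @^-1` _]setTI; apply: measurableI => //; apply: mN.
have Z0 : mu Z = 0%E.
  have [M [mM M0 ZM]] := integrable_ae mD iN.
  apply/eqP; rewrite eq_le measure_ge0 andbT -M0; apply: measure_mono => //.
  by move=> x [Dx /= Nx]; apply: ZM => /(_ Dx); rewrite Nx.
have UF : \bigcup_i F i = D `\` Z.
  apply/seteqP; split=> [x [i _ [Dx /= Nx]]|x [Dx Zx]].
    by split => //; rewrite /Z/= Nx => -[].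
  have [Nx|[k Nk]] := Nval x; first by case: Zx.
  by exists k.
have iU : mu.-integrable (\bigcup_i F i) (N \- cst 1)%E.
  rewrite UF; apply: integrableS iB => //; exact: measurableD.
transitivity (\int[mu]_(x in D `\` Z) (N \- cst 1) x)%E.
  rewrite -UF integral_bigcup//; apply: eq_eseriesr => i _.
  rewrite -integral_cst; last exact: mF.
  by apply: eq_integral => x /set_mem[_ /= ->].
rewrite -negligible_integral// integralB// ND integral_cst// mul1e subee//.
by rewrite ge0_fin_numE.
Qed.

(** The count is at most the indicator of the closed projection interval and at least that of the
    open one; whether the extreme sections are degenerate is immaterial. *)
Lemma integral_convex_slice (R : realType) (u p q : plane R)
    (K : set (plane R)) :
  unit_circle u -> convex_set K -> K° !=set0 ->
  measurable_fun setT (fun t : measurableTypeR R =>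
    @counting _ R (nondegenerate (slice u K t))) ->
  K p -> K q ->
  (forall x, K x -> dot p (rot90 u) <= dot x (rot90 u) <= dot q (rot90 u)) ->
  (\int[lebesgue_measure]_t @counting _ R (nondegenerate (slice u K t)) =
    (dot q (rot90 u) - dot p (rot90 u))%:E)%E.
Proof.
move=> hu vK iK mI Kp Kq pq; pose I t := nondegenerate (slice u K t).
have pq_le : dot p (rot90 u) <= dot q (rot90 u) by have /andP[] := pq q Kq.
have counting1 t : I t tt -> counting (I t) = 1%E :> \bar R.
  move=> It; rewrite (_ : I t = [set tt]) /counting; last first.
    by apply/seteqP; split => -[].
  by rewrite asboolT// fset_set1 cardfs1.
have counting0 t : ~ I t tt -> counting (I t) = 0%E :> \bar R.
  by move=> It; rewrite (_ : I t = set0) ?measure0//; rewrite -subset0 => -[].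
have counting_ge0 t : (0 <= counting (I t) :> \bar R)%E.
  by have [/counting1|/counting0] := pselect (I t tt) => ->.
apply/eqP; rewrite eq_le; apply/andP; split.
  rewrite [leRHS](_ : _ = \int[lebesgue_measure]_t
      (\1_(`[dot p (rot90 u), dot q (rot90 u)] : set R) t)%:E)%E; last first.
    by rewrite integral_indic//= setIT lebesgue_measure_itv_le.
  apply: ge0_le_integral => //.
    by apply/measurable_EFinP; exact: measurable_indic.
  move=> t _; have [It|/counting0 ->//] := pselect (I t tt).
  rewrite counting1// indicE mem_set//= in_itv/=.
  by case: It => a [b [_ Ka _]]; have [_ /= <-] := dot_frame (a, t) hu;
    exact: pq.
rewrite [leLHS](_ : _ = \int[lebesgue_measure]_t
    (\1_(`]dot p (rot90 u), dot q (rot90 u)[ : set R) t)%:E)%E; last first.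
  by rewrite integral_indic//= setIT lebesgue_measure_itv_le.
apply: ge0_le_integral => //.
  by apply/measurable_EFinP; exact: measurable_indic.
move=> t _; rewrite indicE; have [/set_mem|_] := boolP (t \in _);
  last exact: counting_ge0.
rewrite /= in_itv/= => /andP[pt tq]; rewrite counting1//.
by apply: (convex_slice_nondegenerate hu vK iK Kp Kq).
Qed.

Theorem proposition3p7 (R : realType) (A : set (plane R))
  (Acompact : compact A) (Aregular : regclosed A)
  (u : plane R) (hu : unit_circle u)
  (hsections : forall y, orth u y ->
     lambda1 y u
       (chord A u y `+`
        \bigcup_(C in nondegenerate_components (chord A u y)) C) = 0%E)
  (hsum : (\sum_(0 <= i <oo)
     ((i%:R - 1)%:E *
      lambda1 0%R (rot90 u)
        [set y | convex_hull (proj_orth u A) y /\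
                 segment_number A u y = i%:R%:E]) != 0)%E) :
  forall K : set (plane R), convex_body K -> covariogram A <> covariogram K.
Proof.
move=> K [cK vK iK] gAK; move/eqP: hsum; apply.
have AA : A `<=` closure A° by rewrite Aregular.
have KK := convex_closure_interior vK iK.
have K0 : K !=set0 by case: iK => x /interior_subset; exists x.
(* An empty [A] would have zero covariogram at the origin, while [K] has positive area. *)
have A0 : A !=set0.
  apply/set0P/eqP => A0; have [x xK] := iK.
  have : (0 < covariogram K 0%R)%E.
    rewrite covariogram0; apply: (nbhs_lambda2_gt0 _ xK).
    exact: compact_measurable_plane.
  by rewrite -gAK A0 covariogram0 /lambda2 [X in (_ < X)%E]measure0 ltxx.
pose v := rot90 u.
have [p [q [Ap Aq Apq]]] := dot_extrema v Acompact A0.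
have [p' [q' [Kp Kq Kpq]]] := dot_extrema v cK K0.
have width : dot q v - dot p v = dot q' v - dot p' v.
  apply/eqP; rewrite eq_le; apply/andP; split.
    apply: (covariogram_width Acompact AA gAK _ Aq Ap) => x y Kx Ky.
    by have := Kpq x Kx; have := Kpq y Ky; lra.
  apply: (covariogram_width cK KK (esym gAK) _ Kq Kp) => x y Ax Ay.
  by have := Apq x Ax; have := Apq y Ay; lra.
have [mN cvgA] := segment_number_cvg hu Acompact hsections.
have [mI cvgK] := convex_slice_cvg hu cK vK.
pose N t := segment_number A u (t *: v).
pose D : set R := `[dot p v, dot q v]%classic.
have pq : dot p v <= dot q v by have /andP[] := Apq q Aq.
have muD : lebesgue_measure D = (dot q v - dot p v)%:E.
  exact: lebesgue_measure_itv_le.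
have mD : measurable D by exact: measurable_itv.
have NT : (\int[lebesgue_measure]_t N t = lebesgue_measure D)%E.
  rewrite muD width -(integral_convex_slice hu vK iK mI Kp Kq Kpq).
  (* Equal covariograms make the two sequences of difference quotients identical. *)
  by move: cvgA; rewrite gAK => cvgA; exact: cvg_unique cvgA cvgK.
have ND : (\int[lebesgue_measure]_(t in D) N t = lebesgue_measure D)%E.
  rewrite -NT integral_mkcond; apply: eq_integral => t _.
  rewrite patchE; case: ifPn => // /negP tD.
  (* Lines outside the strip miss [A], so [N] vanishes off [D]. *)
  have chord0 : chord A u (t *: v) = set0.
    rewrite -subset0 => x /(chordP _ _ _ hu)[Ax xt]; apply: tD.
    by rewrite mem_set// /D/= in_itv/= -xt; exact: Apq.
  rewrite /N /segment_number (_ : nondegenerate_components _ = set0).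
    by rewrite /counting asboolT// fset_set0.
  by rewrite chord0 -subset0 => C [[x []]].
have Nval t : N t = +oo%E \/ exists k : nat, N t = k%:R%:E.
  rewrite /N /segment_number /counting; case: asboolP => _; last by left.
  by right; eexists.
have Dfin : (lebesgue_measure D < +oo)%E by rewrite muD ltry.
rewrite -[RHS](@level_series_eq0 _ _ R (@lebesgue_measure R) D N mD Dfin mN
  Nval ND).
apply: eq_eseriesr => i _; congr (_ * _)%E; rewrite /lambda1.
congr lebesgue_measure; apply/seteqP; split => t /=.
  by rewrite add0r => -[/(convex_hull_proj _ hu Ap Aq Apq) tD Ni]; split => //.
move=> [tD Ni]; rewrite add0r; split => //;
  apply/(convex_hull_proj _ hu Ap Aq Apq).
by move: tD; rewrite /D/= in_itv.
Qed.
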